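(* Let $\Gamma$ be a finite simplicial graph and let $\mathcal{B}_1$ and $\mathcal{B}_2$ be two right-angled $\Gamma$-buildings with countably infinite rank $1$ residues (every rank $1$ residue of each of them is countably infinite). Then $\mathcal{B}_1$ and $\mathcal{B}_2$ are isomorphic as buildings.
   Context: $W=W(\Gamma)$ is the right-angled Coxeter group with generating set the vertex set $I$ of $\Gamma$ and relations $v^2=1$, and $vw=wv$ for adjacent $v,w$. A chamber system over $I$ is a set (of chambers) with an equivalence relation ($i$-adjacency) for each $i\in I$. A gallery is a finite sequence of chambers with consecutive chambers distinct and $i_j$-adjacent for some $i_j\in I$; its type is the word $i_1\cdots i_k$. For $J\subset I$, a $J$-residue is an equivalence class of chambers under being joined by galleries with type in $J$; its rank is $|J|$. A right-angled $\Gamma$-building is a building of type $W(\Gamma)$: a chamber system $\mathcal{B}$ over $I$ such that each $i$-adjacency class has at least two chambers, with a function $\delta:\mathcal{B}\times\mathcal{B}\to W$ such that for every reduced word $f$ in $I$ representing $w\in W$, chambers $c,c'$ can be joined by a gallery of type $f$ iff $\delta(c,c')=w$. An isomorphism of buildings is a bijection between the sets of chambers preserving, in both directions, $i$-adjacency for every $i\in I$. *)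

(* Defs.v *)
From HB Require Import structures.
From Corelib Require Import RelationClasses.
From mathcomp Require Import all_boot.
From mathcomp Require Import boolp classical_sets functions cardinality.

Set Implicit Arguments.
Unset Strict Implicit.
Unset Printing Implicit Defensive.

Local Open Scope quotient_scope.

(* The right-angled Coxeter group of the graph [e] on the vertex set [I], built
   as words modulo the congruence generated by the defining relations.  The
   quotient monoid is the presented group, each generator being its own
   inverse. *)

Inductive word_equiv (I : finType) (e : rel I) : seq I -> seq I -> Prop :=
| word_refl f : word_equiv e f f
| word_sym f g : word_equiv e f g -> word_equiv e g f
| word_trans f g h : word_equiv e f g -> word_equiv e g h -> word_equiv e f h
| word_cat f f' g g' :
    word_equiv e f f' -> word_equiv e g g' -> word_equiv e (f ++ g) (f' ++ g')
| word_invol v : word_equiv e [:: v; v] [::]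
| word_comm v w : e v w -> word_equiv e [:: v; w] [:: w; v].

Section Racg.
Variables (I : finType) (e : rel I).

Definition word_equivb (f g : seq I) : bool := `[< word_equiv e f g >].

Lemma word_equivb_refl : reflexive word_equivb.
Proof. by move=> f; apply/asboolP; exact: word_refl. Qed.

Lemma word_equivb_sym : symmetric word_equivb.
Proof. by move=> f g; apply/asboolP/asboolP; exact: word_sym. Qed.

Lemma word_equivb_trans : transitive word_equivb.
Proof.
move=> g f h /asboolP fg /asboolP gh.
by apply/asboolP; exact: word_trans gh.
Qed.

Canonical word_equivb_equiv :=
  EquivRel word_equivb word_equivb_refl word_equivb_sym word_equivb_trans.

Definition racg : Type := {eq_quot word_equivb}.

HB.instance Definition _ := Choice.on racg.
HB.instance Definition _ := EqQuotient.on racg.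

Definition racg_of (f : seq I) : racg := \pi_racg f.

Lemma racg_ofP (f g : seq I) : racg_of f = racg_of g <-> word_equiv e f g.
Proof.
split=> [/eqP|fg]; first by rewrite eqmodE => /asboolP.
by apply/eqP; rewrite eqmodE; apply/asboolP.
Qed.

Lemma racg_reprK (x : racg) : racg_of (repr x) = x.
Proof. exact: reprK. Qed.

Lemma racg_of_surj (x : racg) : exists f, x = racg_of f.
Proof. by exists (repr x); rewrite racg_reprK. Qed.

Definition racg_one : racg := racg_of [::].
Definition racg_mul (x y : racg) : racg := racg_of (repr x ++ repr y).
Definition racg_inv (x : racg) : racg := racg_of (rev (repr x)).

Lemma racg_mul_of (f g : seq I) :
  racg_mul (racg_of f) (racg_of g) = racg_of (f ++ g).
Proof. by apply/racg_ofP/word_cat; apply/racg_ofP; exact: racg_reprK. Qed.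

Lemma racg_mulA : associative racg_mul.
Proof.
move=> x y z; have [f ->] := racg_of_surj x.
have [g ->] := racg_of_surj y; have [h ->] := racg_of_surj z.
by rewrite !racg_mul_of catA.
Qed.

Lemma racg_mul1 : left_id racg_one racg_mul.
Proof. by move=> x; have [f ->] := racg_of_surj x; rewrite racg_mul_of. Qed.

Lemma racg_mulr1 : right_id racg_one racg_mul.
Proof.
by move=> x; have [f ->] := racg_of_surj x; rewrite racg_mul_of cats0.
Qed.

Lemma word_equiv_rev_cat (f : seq I) : word_equiv e (rev f ++ f) [::].
Proof.
elim: f => [|i f IHf]; first exact: word_refl.
rewrite rev_cons cat_rcons; apply: word_trans IHf.
apply: word_cat; first exact: word_refl.
exact: (word_cat (word_invol e i) (word_refl e f)).
Qed.

Lemma racg_mulV : left_inverse racg_one racg_inv racg_mul.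
Proof.
move=> x; rewrite -[X in racg_mul _ X]racg_reprK racg_mul_of.
by apply/racg_ofP; exact: word_equiv_rev_cat.
Qed.

Lemma racg_mulrV : right_inverse racg_one racg_inv racg_mul.
Proof.
move=> x; rewrite -[X in racg_mul X _]racg_reprK racg_mul_of.
by apply/racg_ofP; rewrite -{1}[repr x]revK; exact: word_equiv_rev_cat.
Qed.

HB.instance Definition _ := isGroup.Build racg
  racg_mulA racg_mul1 racg_mulr1 racg_mulV racg_mulrV.

Definition racg_gen (i : I) : racg := racg_of [:: i].

Definition word_val (f : seq I) : racg := (\prod_(i <- f) racg_gen i)%g.

Lemma word_valE (f : seq I) : word_val f = racg_of f.
Proof.
rewrite /word_val; elim: f => [|i f IHf]; first by rewrite big_nil.
by rewrite big_cons IHf; exact: racg_mul_of.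
Qed.

Definition reduced (f : seq I) : Prop :=
  forall g : seq I, word_val g = word_val f -> size f <= size g.

End Racg.

Record chamber_system (I : finType) := ChamberSystem {
  chamber :> Type;
  adj : I -> chamber -> chamber -> Prop;
  adj_equiv : forall i, Equivalence (adj i)
}.

Section Galleries.
Variables (I : finType) (B : chamber_system I).

(* [gallery c p f]: the sequence of chambers [c :: p] is a gallery of type
   [f]. *)
Fixpoint gallery (c : B) (p : seq B) (f : seq I) : Prop :=
  match p, f with
  | [::], [::] => True
  | d :: p', i :: f' => [/\ c <> d, adj i c d & gallery d p' f']
  | _, _ => False
  end.

Definition joined (f : seq I) (c c' : B) : Prop :=
  exists2 p : seq B, gallery c p f & last c p = c'.

(* The [J]-residue containing [c]; its rank is [#|J|]. *)
Definition residue (J : {set I}) (c : B) : set B :=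
  [set c' | exists2 f : seq I, {subset f <= J} & joined f c c']%classic.

End Galleries.

(* Buildings are nonempty by convention: the empty chamber system satisfies
   the other axioms vacuously. *)
Record ra_building (I : finType) (e : rel I) := RABuilding {
  building_system :> chamber_system I;
  building_inhabited : inhabited building_system;
  building_thick2 : forall (i : I) (c : building_system),
    exists2 c' : building_system, adj i c c' & c' <> c;
  building_dist : building_system -> building_system -> racg e;
  building_distP : forall (f : seq I) (c c' : building_system),
    reduced e f -> joined f c c' <-> building_dist c c' = word_val e f
}.

Definition countably_infinite_rank1_residues (I : finType)
    (B : chamber_system I) : Prop :=
  forall (J : {set I}) (c : B), #|J| = 1 ->
    (residue J c #= [set: nat])%card.

Definition building_iso (I : finType) (B1 B2 : chamber_system I) : Prop :=
  exists2 phi : B1 -> B2, bijective phi &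
    forall (i : I) (c c' : B1), adj i c c' <-> adj i (phi c) (phi c').

(* Main.v *)
From Corelib Require Import RelationClasses.
Require Import Defs.
From mathcomp Require Import all_boot.
From mathcomp Require Import ssralg rat.
From mathcomp Require Import boolp classical_sets cardinality.

(** One group, the graph product over [e] of copies of the additive group of
    the rationals, acts simply transitively on both buildings with the same
    rule for adjacency.

    In a right-angled building, opposite sides of a commuting square let one
    slide an [i]-panel along the generators adjacent to [i]; an [i]-panel then
    meets each class of chambers that such slides connect at most once
    ([adj_perp_eq]).  Hence one may coordinatize all [i]-panels by a fixed
    countably infinite abelian group, here the rationals, so that coordinates
    are unchanged under [j]-adjacency whenever [j] is adjacent to [i]
    ([panel_coordinates_exist]).  Adding a group element to the [i]-coordinate
    inside the [i]-panel of a chamber then defines the action of the graph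
    product.

    Instead of that group, the proof uses pairs of chambers, one in each
    building, with two pairs [i]-adjacent when both components are and the
    [i]-coordinates change by the same amount ([coupled]).  The connected
    component of one pair is the graph of the isomorphism.  It is total because
    every step of a gallery lifts ([coupled_lift]).  It is single-valued for the
    following reason: coupled pairs again have commuting squares, so a path
    between two pairs with the same first component can be shortened to a
    gallery whose type admits no cancellation up to commutation
    ([walk_reduce]); its projection is a closed gallery of reduced type, hence
    empty.  Everything is symmetric in the two buildings.

    The main fact needed on the Coxeter group is that a word without a
    cancellable pair of equal letters is of minimal length
    ([cancellation_free_reduced]). *)

Set Implicit Arguments.
Unset Strict Implicit.
Unset Printing Implicit Defensive.

(** * The word problem in a right-angled Coxeter group *)

Section Words.
Variables (I : finType) (e : rel I).
Hypotheses (e_sym : symmetric e) (e_irr : irreflexive e).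
Implicit Types (i j k : I) (f g h : seq I).

(** Whether some occurrence of [i] can be moved to the front of the word by
    commutations alone. *)
Fixpoint exposed i f : bool :=
  if f is j :: f' then (i == j) || e i j && exposed i f' else false.

Fixpoint cancellation_free f : bool :=
  if f is i :: f' then ~~ exposed i f' && cancellation_free f' else true.

Lemma exposed_split i f : exposed i f ->
  exists a b, f = a ++ i :: b /\ all (e i) a.
Proof.
elim: f => //= j f IHf /orP[/eqP <-|/andP[eij /IHf[a [b [-> ha]]]]].
  by exists [::], f.
by exists (j :: a), b; rewrite /= eij.
Qed.

Lemma not_cancellation_free f : ~~ cancellation_free f ->
  exists a i b c, f = a ++ i :: b ++ i :: c /\ all (e i) b.
Proof.
elim: f => //= i f IHf; rewrite negb_and negbK.
case/orP=> [/exposed_split[b [c [-> hb]]]|/IHf[a [j [b [c [-> hb]]]]]].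
  by exists [::], i, b, c.
by exists (i :: a), j, b, c.
Qed.

(** Equality in the partially commutative monoid, encoded by the classical
    projection criterion: two words agree up to commutations iff their
    restrictions to each pair of non-commuting letters agree.  Reflexivity,
    symmetry and transitivity then come for free from equality of words.  The
    case [i = j] counts occurrences. *)
Definition trace_eq f g :=
  forall i j, ~~ e i j -> filter (pred2 i j) f = filter (pred2 i j) g.

(** This form shows that exposure depends only on the trace of the word.  The
    choice [j = i] forces [i] to occur at all. *)
Lemma exposedP i f :
  reflect (forall j, ~~ e i j -> ohead (filter (pred2 i j) f) = Some i)
          (exposed i f).
Proof.
elim: f => [|k f IHf] /=.
  by constructor => /(_ i); rewrite e_irr => /(_ isT).
have [<-|neq_ik] /= := eqVneq i k; first by constructor.
case eik: (e i k) => /=; last first.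
  constructor => /(_ k); rewrite eik eqxx => /(_ isT)[ki].
  by rewrite ki eqxx in neq_ik.
apply: (iffP IHf) => H j nij; have := H j nij;
  by case: eqVneq nij => // <-; rewrite eik.
Qed.

Lemma exposed_trace i f g : trace_eq f g -> exposed i f = exposed i g.
Proof.
by move=> fg; apply/exposedP/exposedP=> H j nij; have := H j nij;
  rewrite (fg i j nij).
Qed.

Lemma filter_rem (p : pred I) i f :
  filter p (rem i f) = rem i (filter p f).
Proof.
elim: f => //= j f IHf; have [->|ji] := eqVneq j i.
  case: ifP => [|pi] /=; first by rewrite eqxx.
  by rewrite rem_id // mem_filter pi.
by rewrite /= IHf; case: ifP => //= _; rewrite (negPf ji).
Qed.

Lemma rem_trace i f g : trace_eq f g -> trace_eq (rem i f) (rem i g).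
Proof. by move=> fg j k njk; rewrite !filter_rem (fg j k njk). Qed.

Lemma cons_trace i f g : trace_eq f g -> trace_eq (i :: f) (i :: g).
Proof. by move=> fg j k njk /=; rewrite (fg j k njk). Qed.

Lemma swap_trace i j f : e i j -> trace_eq (i :: j :: f) (j :: i :: f).
Proof.
move=> eij k l nkl /=.
case ki: (_ || _); case kj: (_ || _) => //.
move: eij ki kj nkl => /[swap] /pred2P[]-> /[swap] /pred2P[]->;
  by rewrite ?e_irr // => eij; rewrite ?eij // e_sym eij.
Qed.

Lemma exposed_rem_trace i f : exposed i f -> trace_eq f (i :: rem i f).
Proof.
elim: f => //= k f IHf; have [<-|neq_ik] /= := eqVneq i k.
  by move=> _ ? ?.
case/andP=> eik /IHf fE j l njl; rewrite (cons_trace k fE njl).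
by apply: swap_trace njl; rewrite e_sym.
Qed.

Lemma exposed_rem i j f : e i j -> exposed i (rem j f) = exposed i f.
Proof.
move=> eij; have neq_ij : i != j by apply: contraTneq eij => ->; rewrite e_irr.
elim: f => //= k f IHf; have [->|kj] := eqVneq k j.
  by rewrite (negPf neq_ij) eij.
by rewrite /= IHf.
Qed.

Lemma cancellation_free_rem i f : exposed i f -> cancellation_free f ->
  cancellation_free (rem i f) && ~~ exposed i (rem i f).
Proof.
elim: f => //= j f IHf; have [<-|neq_ij] /= := eqVneq i j.
  by move=> _ /andP[-> ->].
case/andP=> eij xf /andP[nxj cf]; have /andP[-> nxi] := IHf xf cf.
by rewrite (negPf neq_ij) eij nxi exposed_rem ?nxj // e_sym.
Qed.

(** Left multiplication by the generator [i] on cancellation-free words; up to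
    [trace_eq] it defines an action of the Coxeter group, from which normal
    forms are read off. *)
Definition push i f := if exposed i f then rem i f else i :: f.

Lemma push_trace i f g : trace_eq f g -> trace_eq (push i f) (push i g).
Proof.
move=> fg; rewrite /push (exposed_trace i fg).
by case: ifP => _; [exact: rem_trace | exact: cons_trace].
Qed.

Lemma push_cancellation_free i f :
  cancellation_free f -> cancellation_free (push i f).
Proof.
rewrite /push; case: ifP => [xf|/= -> ->//].
by move=> /(cancellation_free_rem xf)/andP[].
Qed.

(** Without the hypothesis this fails: two copies of [i] may be exposed one
    after the other, and pushing [i] twice then removes both. *)
Lemma push_push i f : cancellation_free f -> trace_eq (push i (push i f)) f.
Proof.
move=> cf; rewrite {2}/push; case: ifPn => [xf|nxf].
  have /andP[_ nx] := cancellation_free_rem xf cf.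
  by rewrite /push (negPf nx) => j k njk; rewrite -(exposed_rem_trace xf).
by rewrite /push /= eqxx.
Qed.

Lemma push_comm i j f : e i j ->
  trace_eq (push i (push j f)) (push j (push i f)).
Proof.
move=> eij; have eji : e j i by rewrite e_sym.
have neq_ij : i != j by apply: contraTneq eij => ->; rewrite e_irr.
have neq_ji : j != i by rewrite eq_sym.
rewrite /push; case xj: (exposed j f); case xi: (exposed i f);
  rewrite /= ?exposed_rem ?xi ?xj //= ?eij ?eji ?xi ?xj /=
    ?(negPf neq_ij) ?(negPf neq_ji) //=.
- have remC : rem i (rem j f) = rem j (rem i f).
    elim: (f) => //= k s IHs; have [->|kj] := eqVneq k j.
      by rewrite (negPf neq_ji) /= eqxx.
    have [->|ki] := eqVneq k i; first by rewrite /= eqxx.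
    by rewrite /= (negPf kj) (negPf ki) IHs.
  by rewrite remC.
- by apply: swap_trace.
Qed.

Definition push_word f g := foldr push g f.

Lemma push_word_trace f g h :
  trace_eq g h -> trace_eq (push_word f g) (push_word f h).
Proof. by move=> gh; elim: f => //= i f; exact: push_trace. Qed.

Lemma push_word_cancellation_free f g :
  cancellation_free g -> cancellation_free (push_word f g).
Proof. by move=> cg; elim: f => //= i f; exact: push_cancellation_free. Qed.

Lemma push_word_equiv f g : word_equiv e f g -> forall h,
  cancellation_free h -> trace_eq (push_word f h) (push_word g h).
Proof.
elim=> {f g} => [//|f g _ IH h ch i j nij|f g k _ IH1 _ IH2 h ch i j nij
  |f f' g g' _ IHf _ IHg h ch i j nij|i h|i j eij h _].
- by rewrite (IH h ch i j nij).
- by rewrite (IH1 h ch i j nij) (IH2 h ch i j nij).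
- rewrite /push_word !foldr_cat -!/(push_word _ _).
  rewrite (IHf _ (push_word_cancellation_free g ch) i j nij).
  exact: push_word_trace (IHg h ch) i j nij.
- exact: push_push.
- exact: push_comm.
Qed.

Lemma push_word_id f : cancellation_free f -> push_word f [::] = f.
Proof.
by elim: f => //= i f IHf /andP[/negPf nx /IHf ->]; rewrite /push nx.
Qed.

Lemma size_push_word f : size (push_word f [::]) <= size f.
Proof.
elim: f => //= i f IHf; rewrite /push; case: ifP => _ //=.
apply: leq_trans (leqW IHf); exact: size_subseq (rem_subseq _ _).
Qed.

Lemma trace_size f g : trace_eq f g -> size f = size g.
Proof.
move=> fg; apply: perm_size; apply/allP=> i _ /=; apply/eqP.
have := fg i i; rewrite e_irr => /(_ isT) /(congr1 size); rewrite !size_filter.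
by rewrite !(@eq_count _ (pred2 i i) (pred1 i)) // => j /=; rewrite orbb.
Qed.

(** A cancellation-free word is its own normal form, computing normal forms
    never lengthens a word, and equivalent words have the same normal form up to
    commutations. *)
Lemma cancellation_free_reduced f : cancellation_free f -> reduced e f.
Proof.
move=> cf g; rewrite !word_valE => /racg_ofP /push_word_equiv/(_ [::] isT).
by rewrite (push_word_id cf) => /trace_size <-; exact: size_push_word.
Qed.

(** The defining relations preserve the parity of the number of occurrences of
    a letter, so no generator lies in the subgroup generated by the others. *)
Lemma word_equiv_odd_count i f g : word_equiv e f g ->
  odd (count_mem i f) = odd (count_mem i g).
Proof.
elim=> {f g} => [//|//|f g h _ -> _ ->//|f f' g g' _ IHf _ IHg|j|j k _] /=.
- by rewrite !count_cat !oddD IHf IHg.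
- by rewrite addn0 addnn odd_double.
- by rewrite !addn0 addnC.
Qed.

Lemma reduced_word_exists (w : racg e) :
  exists2 f, reduced e f & word_val e f = w.
Proof.
have exn : exists n, `[< exists2 f, size f = n & word_val e f = w >].
  have [f ->] := racg_of_surj w; exists (size f); apply/asboolP.
  by exists f => //; rewrite word_valE.
case: (ex_minnP exn) => n /asboolP[f <- fw] minf; exists f => // g gf.
by apply: minf; apply/asboolP; exists g => //; rewrite gf.
Qed.

End Words.

(** * Galleries with repetitions *)

Section Walks.
Variable I : finType.

Lemma adj_refl (B : chamber_system I) i (c : B) : adj i c c.
Proof. by have [] := adj_equiv B i. Qed.

Lemma adj_sym (B : chamber_system I) i (c d : B) : adj i c d -> adj i d c.
Proof. by have [_ + _] := adj_equiv B i; apply. Qed.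

Lemma adj_trans (B : chamber_system I) i (c d x : B) :
  adj i c d -> adj i d x -> adj i c x.
Proof. by have [_ _] := adj_equiv B i; apply. Qed.

Variables (e : rel I) (B : chamber_system I).
Implicit Types (i j k : I) (f g : seq I) (c d x y : B).

(** A gallery that may pause.  Unlike galleries, walks of given type compose
    well with transitivity of adjacency and lift along projections. *)
Fixpoint walk f c d : Prop :=
  if f is i :: f' then exists2 x, adj i c x & walk f' x d else c = d.

Lemma joined_nil c d : joined [::] c d <-> c = d.
Proof. by split=> [[[|//] _]|->]; last exists [::]. Qed.

Lemma joined_cons i f c d :
  joined (i :: f) c d <-> exists x, [/\ c <> x, adj i c x & joined f x d].
Proof.
split=> [[[//|x p] /= [cx acx gp] lp]|[x [cx acx [p gp lp]]]].
  by exists x; split=> //; exists p.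
by exists (x :: p).
Qed.

Lemma joined_walk f c d : joined f c d -> walk f c d.
Proof.
elim: f c => [|i f IHf] c; first by move/joined_nil.
by case/joined_cons=> x [_ acx /IHf]; exists x.
Qed.

Lemma walk_cat f g c d :
  walk (f ++ g) c d <-> exists2 x, walk f c x & walk g x d.
Proof.
elim: f c => [|i f IHf] c /=; first by split=> [|[x ->]]; first by exists c.
split=> [[x cx /IHf[y xy yd]]|[y [x cx xy] yd]].
  by exists y => //; exists x.
by exists x => //; apply/IHf; exists y.
Qed.

Lemma walk_rev f c d : walk f c d -> walk (rev f) d c.
Proof.
elim: f c => [|i f IHf] c /=; first by move->.
case=> x cx /IHf dx; rewrite rev_cons -cats1; apply/walk_cat.
by exists x => //; exists c => //; exact: adj_sym.
Qed.

Lemma walk_stutter f c d : walk f c d ->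
  joined f c d \/
  exists g, [/\ size g < size f, {subset g <= f} & walk g c d].
Proof.
elim: f c => [|i f IHf] c /=; first by move/joined_nil; left.
case=> x cx xd; have [eq_cx|neq_cx] := EM (c = x).
  by right; exists f; rewrite eq_cx; split=> // j jf; rewrite inE jf orbT.
case: (IHf x xd) => [xd'|[g [sg gf xd']]].
  by left; apply/joined_cons; exists x.
right; exists (i :: g); split=> //; last by exists x.
by move=> j; rewrite !inE => /orP[->//|/gf->]; rewrite orbT.
Qed.

(** The square-filling property.  It holds in right-angled buildings and passes
    to the coupling of two buildings, which need not be a building. *)
Definition commuting :=
  forall i j c x d, e i j -> adj i c x -> adj j x d ->
  exists2 y, adj j c y & adj i y d.

Hypothesis B_comm : commuting.

Lemma walk_shift i f c d : all (e i) f ->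
  walk (i :: f) c d -> exists2 y, walk f c y & adj i y d.
Proof.
elim: f c => [|j f IHf] c /=; first by move=> _ [x cx <-]; exists c.
case/andP=> eij ef [x cx [y xy yd]]; have [z cz zy] := B_comm eij cx xy.
by have [|t zt td] := IHf z ef; [exists y | exists t => //; exists z].
Qed.

(** A repeated chamber or a cancellable pair of letters allows a shorter walk:
    the two equal letters are made consecutive by [walk_shift] and merged into
    one by transitivity of adjacency. *)
Lemma walk_reduce f c d : walk f c d ->
  exists g, [/\ cancellation_free e g, {subset g <= f} & joined g c d].
Proof.
have [n] := ubnP (size f); elim: n f => // n IHn f /ltnSE szf cfd.
have shorten g : size g < size f -> {subset g <= f} -> walk g c d ->
  exists g, [/\ cancellation_free e g, {subset g <= f} & joined g c d].
  move=> sg gf /(IHn g (leq_trans sg szf))[h [ch hg cd]].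
  by exists h; split=> // j /hg /gf.
have [cf|/not_cancellation_free] := boolP (cancellation_free e f).
  case: (walk_stutter cfd) => [cd|[g [sg gf gcd]]]; first by exists f; split.
  exact: shorten gcd.
move=> [a [i [b [f' [fE eb]]]]].
apply: (shorten (a ++ b ++ i :: f')).
- by rewrite fE !size_cat /= !size_cat /= ltn_add2l.
- by move=> j; rewrite fE !(mem_cat, inE) => /or4P[]->; rewrite ?orbT.
move: cfd; rewrite fE => /walk_cat[x cx [y xy /walk_cat[z yz [t zt td]]]].
have [|s xs sz] := @walk_shift i b x z eb; first by exists y.
apply/walk_cat; exists x => //; apply/walk_cat; exists s => //.
by exists t => //; exact: adj_trans sz zt.
Qed.

End Walks.

(** * Commuting squares and sliding panels in a building *)

Section Building.
Variables (I : finType) (e : rel I).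
Hypotheses (e_sym : symmetric e) (e_irr : irreflexive e).
Variable B : ra_building e.
Implicit Types (i j : I) (f : seq I) (c d x y : B).

Lemma joined_dist f c d : cancellation_free e f ->
  joined f c d <-> building_dist c d = word_val e f.
Proof.
by move=> cf; apply: building_distP; exact: cancellation_free_reduced.
Qed.

Lemma joined_loop f c : cancellation_free e f -> joined f c c -> f = [::].
Proof.
move=> cf /(joined_dist _ _ cf) df.
have /(joined_dist (f := [::]) c c isT) dnil : joined [::] c c.
  exact/joined_nil.
apply: size0nil; apply/eqP; rewrite -leqn0.
by apply: (cancellation_free_reduced e_sym e_irr cf (g := [::])); rewrite -df.
Qed.

(** The words [i j] and [j i] are reduced and represent the same element, so
    galleries of these two types join the same chambers. *)
Lemma building_commuting : commuting e B.
Proof.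
move=> i j c x d eij cx xd.
have [eq_cx|neq_cx] := EM (c = x).
  by rewrite eq_cx; exists d => //; exact: adj_refl.
have [eq_xd|neq_xd] := EM (x = d).
  by rewrite -eq_xd; exists c => //; exact: adj_refl.
have neq_ij : i != j by apply: contraTneq eij => ->; rewrite e_irr.
have eji : e j i by rewrite e_sym.
have cij : cancellation_free e [:: i; j] by rewrite /= (negPf neq_ij) eij.
have cji : cancellation_free e [:: j; i].
  by rewrite /= eq_sym (negPf neq_ij) eji.
have cd : joined [:: i; j] c d.
  apply/joined_cons; exists x; split=> //.
  by apply/joined_cons; exists d; split=> //; apply/joined_nil.
have: joined [:: j; i] c d.
  apply/(joined_dist _ _ cji); move/(joined_dist _ _ cij): cd => ->.
  by rewrite !word_valE; apply/racg_ofP; exact: word_comm.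
case/joined_cons=> y [_ cy /joined_cons[z [_ yz /joined_nil zd]]].
by exists y; rewrite // -zd.
Qed.

Lemma building_connected c d : exists f, walk f c d.
Proof.
have [f rf fw] := reduced_word_exists (building_dist c d).
by exists f; apply: joined_walk; apply/building_distP.
Qed.

(** Being in the same residue over the set of generators adjacent to [i]. *)
Definition perp_connected i c d := exists2 f, all (e i) f & walk f c d.

Lemma perp_refl i c : perp_connected i c c.
Proof. by exists [::]. Qed.

Lemma perp_sym i c d : perp_connected i c d -> perp_connected i d c.
Proof. by case=> f ef /walk_rev; exists (rev f); rewrite // all_rev. Qed.

Lemma perp_trans i c d x :
  perp_connected i c d -> perp_connected i d x -> perp_connected i c x.
Proof.
case=> f ef cd [g eg dx]; exists (f ++ g); first by rewrite all_cat ef.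
by apply/walk_cat; exists d.
Qed.

Lemma adj_perp i c x d : adj i c x -> perp_connected i x d ->
  exists2 y, perp_connected i c y & adj i y d.
Proof.
move=> cx [f ef xd].
have [|y cy yd] := walk_shift building_commuting (i := i) (c := c) (d := d) ef.
  by exists x.
by exists y => //; exists f.
Qed.

(** Otherwise the generator [i] would be a product of generators adjacent to
    it, against [word_equiv_odd_count]. *)
Lemma adj_perp_eq i c d : adj i c d -> perp_connected i c d -> c = d.
Proof.
move=> cd [f ef /(walk_reduce building_commuting)[g [cg gf gcd]]].
apply: contrapT => neq_cd.
have ci : cancellation_free e [:: i] by [].
have: joined [:: i] c d.
  by apply/joined_cons; exists d; split=> //; apply/joined_nil.
move/(joined_dist _ _ ci); move/(joined_dist _ _ cg): gcd => ->.
rewrite !word_valE => /racg_ofP/(word_equiv_odd_count i) /=.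
rewrite eqxx (count_memPn _) //; apply/negP=> /gf/(allP ef).
by rewrite e_irr.
Qed.

Lemma residue1E i c d : residue [set i]%SET c d <-> adj i c d.
Proof.
split=> [[f fi /joined_walk]|cd].
  elim: f c fi => [|j f IHf] c fi /=; first by move=> <-; exact: adj_refl.
  have /set1P-> : j \in [set i]%SET by apply: fi; exact: mem_head.
  case=> x cx /IHf xd; apply: adj_trans cx (xd _) => k kf.
  by apply: fi; rewrite inE kf orbT.
have [<-|neq_cd] := EM (c = d); first by exists [::] => //; apply/joined_nil.
exists [:: i]; first by move=> j; rewrite !inE.
by apply/joined_cons; exists d; split=> //; apply/joined_nil.
Qed.

End Building.

(** * Panel coordinates *)

(** A coordinate for each generator [i] that is bijective on every [i]-panel and
    transported unchanged along the slides of these panels.  Any countably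
    infinite abelian group could serve as the range; subtraction is used only to
    compare increments. *)
Definition panel_coordinates (I : finType) (e : rel I) (B : chamber_system I)
    (b : I -> B -> rat) :=
  [/\ forall i j c d, e i j -> adj j c d -> b i c = b i d,
      forall i c d, adj i c d -> b i c = b i d -> c = d &
      forall i c z, exists2 d, adj i c d & b i d = z].

Lemma class_representatives (T : Type) (E : T -> T -> Prop) : inhabited T ->
  (forall x, E x x) -> (forall x y, E x y -> E y x) ->
  (forall x y z, E x y -> E y z -> E x z) ->
  exists r : T -> T, (forall x, E x (r x)) /\ forall x y, E x y -> r x = r y.
Proof.
move=> [x0] Er Es Et.
have /choice[r rP] : forall A : T -> Prop, exists y, (exists x, A x) -> A y.
  by move=> A; have [[x Ax]|nA] := EM (exists x, A x); [exists x | exists x0].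
exists (r \o E); split=> [x|x y Exy] /=; first by apply: rP; exists x.
congr r; apply/funext => z; apply/propext.
by split; apply: Et => //; exact: Es.
Qed.

(** Choose one panel in each residue over [i] and its neighbours, a bijection
    from this panel to the rationals, and extend it to the residue by projecting
    each chamber to the panel along the generators adjacent to [i]. *)
Lemma panel_coordinates_exist (I : finType) (e : rel I) (e_sym : symmetric e)
    (e_irr : irreflexive e) (B : ra_building e) :
  countably_infinite_rank1_residues B ->
  exists b : I -> B -> rat, panel_coordinates e b.
Proof.
move=> B_inf.
suff /choice[b bP] : forall i, exists b : B -> rat,
  [/\ forall j c d, e i j -> adj j c d -> b c = b d,
      forall c d, adj i c d -> b c = b d -> c = d &
      forall c z, exists2 d, adj i c d & b d = z].
  by exists b; split=> i; case: (bP i).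
(* [near] is membership in the same residue over [i] and its neighbours; such a
   residue is a product, so one step of type [i] always suffices. *)
move=> i; pose near (c d : B) := exists2 x, adj i c x & perp_connected i x d.
have near_sym (c d : B) : near c d -> near d c.
  case=> x cx xd; have [y cy yd] := adj_perp e_sym e_irr cx xd.
  by exists y; [exact: adj_sym | exact: perp_sym].
have near_trans (c d x : B) : near c d -> near d x -> near c x.
  case=> y cy yd [t dt tx].
  have [s ts sy] := adj_perp e_sym e_irr (adj_sym dt) (perp_sym yd).
  exists s; first exact: adj_trans cy (adj_sym sy).
  exact: perp_trans (perp_sym ts) tx.
have near_refl (c : B) : near c c.
  by exists c; [exact: adj_refl | exact: perp_refl].
have [r [rE r_eq]] :=
  class_representatives (building_inhabited B) near_refl near_sym near_trans.
have /choice[pr prP] : forall c,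
    exists x, adj i (r c) x /\ perp_connected i x c.
  by move=> c; have /near_sym[x] := rE c; exists x.
have /choice[b bP] : forall p, exists b : B -> rat,
    (forall c d, adj i p c -> adj i p d -> b c = b d -> c = d) /\
    forall z, exists2 d, adj i p d & b d = z.
  move=> p; have := B_inf [set i]%SET p (cards1 i).
  move=> /card_eq_trans/(_ (card_esym card_rat)).
  move=> /card_set_bijP[b [_ b_inj b_surj]].
  exists b; split=> [c d pc pd|z].
    by apply: b_inj; rewrite in_setE; apply/residue1E.
  by have [d /residue1E] := b_surj z Logic.I; exists d.
have pr_uniq (p x y : B) :
    adj i p x -> adj i p y -> perp_connected i x y -> x = y.
  move=> px py; apply: (adj_perp_eq e_sym e_irr).
  exact: adj_trans (adj_sym px) py.
have pr_eq (c x : B) : adj i (r c) x -> perp_connected i x c -> x = pr c.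
  move=> rx xc; have [rpr prc] := prP c.
  by apply: pr_uniq rx rpr _; exact: perp_trans xc (perp_sym prc).
exists (fun c => b (r c) (pr c)); split.
- move=> j c d eij cd.
  have perp_cd : perp_connected i c d.
    by exists [:: j]; rewrite /= ?eij //; exists d.
  have rcd : r c = r d by apply: r_eq; exists c => //; exact: adj_refl.
  have [rpr prc] := prP c; rewrite -rcd; congr (b _ _).
  by apply: pr_eq; rewrite -?rcd //; exact: perp_trans prc perp_cd.
- move=> c d cd; have rcd : r c = r d.
    by apply: r_eq; exists d => //; exact: perp_refl.
  have [[rc prc] [rd prd]] := (prP c, prP d); rewrite -rcd in rd *.
  move/(bP (r c)).1 => /(_ rc rd) prcd.
  apply: (adj_perp_eq e_sym e_irr cd); rewrite -prcd in prd.
  exact: perp_trans (perp_sym prc) prd.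
- move=> c z; have [x rx bx] := (bP (r c)).2 z; have [rpr prc] := prP c.
  have [d cd dx] : exists2 d, adj i c d & perp_connected i d x.
    have [] := adj_perp e_sym e_irr (adj_trans (adj_sym rx) rpr) prc.
    by move=> d xd dc; exists d; [exact: adj_sym | exact: perp_sym].
  have rcd : r c = r d by apply: r_eq; exists d => //; exact: perp_refl.
  exists d => //; rewrite -rcd -(pr_eq d x) ?bx -?rcd //; exact: perp_sym.
Qed.

(** * The coupling of two buildings *)

Section CoupledSystem.
Variables (I : finType) (B1 B2 : chamber_system I).
Variables (b1 : I -> B1 -> rat) (b2 : I -> B2 -> rat).
Implicit Types (i j : I) (p q : B1 * B2).

Definition coupled_adj i p q : Prop :=
  [/\ adj i p.1 q.1, adj i p.2 q.2 &
      (b1 i p.1 - b2 i p.2 = b1 i q.1 - b2 i q.2)%R].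

Lemma coupled_adj_equiv i : Equivalence (coupled_adj i).
Proof.
split=> [p|p q [? ? ?]|p q t [p1 p2 pb] [q1 q2 qb]].
- by split=> //; exact: adj_refl.
- by split=> //; exact: adj_sym.
- split; [exact: adj_trans p1 q1 | exact: adj_trans p2 q2 | by rewrite pb].
Qed.

Definition coupled : chamber_system I := ChamberSystem coupled_adj_equiv.
End CoupledSystem.

Section Coupled.
Variables (I : finType) (e : rel I).
Hypotheses (e_sym : symmetric e) (e_irr : irreflexive e).
Variables (B1 B2 : ra_building e) (b1 : I -> B1 -> rat) (b2 : I -> B2 -> rat).
Hypotheses (b1P : panel_coordinates e b1) (b2P : panel_coordinates e b2).
Local Notation Z := (coupled b1 b2).
Implicit Types (i j : I) (f : seq I).

(** A step of type [j] preserves all coordinates indexed by neighbours of [j],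
    so opposite sides of a commuting square have equal increments. *)
Lemma coupled_commuting : commuting e Z.
Proof.
move=> i j [c1 c2] [x1 x2] [d1 d2] eij [/= cx1 cx2 cxb] [/= xd1 xd2 xdb].
have eji : e j i by rewrite e_sym.
have [y1 cy1 yd1] := building_commuting e_sym e_irr eij cx1 xd1.
have [y2 cy2 yd2] := building_commuting e_sym e_irr eij cx2 xd2.
have [[inv1 _ _] [inv2 _ _]] := (b1P, b2P).
exists (y1, y2); split=> //=.
- rewrite (inv1 _ _ _ _ eji cx1) (inv2 _ _ _ _ eji cx2) xdb.
  by rewrite (inv1 _ _ _ _ eji yd1) (inv2 _ _ _ _ eji yd2).
- rewrite -(inv1 _ _ _ _ eij cy1) -(inv2 _ _ _ _ eij cy2) cxb.
  by rewrite (inv1 _ _ _ _ eij xd1) (inv2 _ _ _ _ eij xd2).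
Qed.

Lemma coupled_lift i (p : Z) (c : B1) :
  adj i p.1 c -> exists d, adj (c := Z) i p (c, d).
Proof.
case: p => c0 d0 /= c0c; have [_ _ /(_ i d0)] := b2P.
case/(_ (b1 i c - (b1 i c0 - b2 i d0)))%R=> d d0d bd; exists d; split=> //=.
by rewrite bd GRing.subKr.
Qed.

(** Equal increments make a step pause in one component exactly when it
    pauses in the other, so galleries project to galleries. *)
Lemma coupled_joined_fst f (p q : Z) : joined f p q -> joined f p.1 q.1.
Proof.
elim: f p => [|i f IHf] p; first by move=> /joined_nil->; apply/joined_nil.
case/joined_cons=> x [neq_px [px1 px2 pxb] /IHf xq]; apply/joined_cons.
exists x.1; split=> // eq_px; case: neq_px; move: pxb px2; rewrite eq_px.
have [_ inj _] := b2P => /GRing.addrI/GRing.oppr_inj b_eq px2.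
by case: p x eq_px b_eq px2 {px1 xq} => [p1 p2] [x1 x2] /= -> b_eq /inj->.
Qed.

(** The two walks give a walk from [(c, d)] to [(c, d')]; once reduced, its
    projection is a closed gallery of reduced type, hence trivial. *)
Lemma coupled_functional f g (p : Z) c d d' :
  walk f p (c, d) -> walk g p (c, d') -> d = d'.
Proof.
move=> /walk_rev pd pd'.
have: walk (rev f ++ g) ((c, d) : Z) (c, d') by apply/walk_cat; exists p.
case/(walk_reduce coupled_commuting)=> h [ch _ dd'].
have h0 := joined_loop e_sym e_irr ch (coupled_joined_fst dd').
by move: dd'; rewrite h0 => /joined_nil[].
Qed.

Lemma coupled_total (p : Z) c : exists d f, walk f p (c, d).
Proof.
have [f] := building_connected p.1 c; elim: f p => [|i f IHf] p /=.
  by case: p => c0 d0 /= ->; exists d0, [::].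
case=> x /coupled_lift[y py] /(IHf (x, y))[d [g xd]].
by exists d, (i :: g); exists (x, y).
Qed.

End Coupled.

Lemma walk_coupledC (I : finType) (B1 B2 : chamber_system I)
    (b1 : I -> B1 -> rat) (b2 : I -> B2 -> rat) f (p q : coupled b1 b2) :
  walk f p q -> walk f ((p.2, p.1) : coupled b2 b1) (q.2, q.1).
Proof.
elim: f p => [|i f IHf] p /=; first by move->.
case=> x [px1 px2 pxb] /IHf xq; exists (x.2, x.1) => //; split=> //=.
by rewrite -GRing.opprB pxb GRing.opprB.
Qed.

Theorem corollary5p23 (I : finType) (e : rel I)
    (e_sym : symmetric e) (e_irr : irreflexive e)
    (B1 B2 : ra_building e)
    (B1_inf : countably_infinite_rank1_residues B1)
    (B2_inf : countably_infinite_rank1_residues B2) :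
  building_iso B1 B2.
Proof.
have [b1 b1P] := panel_coordinates_exist e_sym e_irr B1_inf.
have [b2 b2P] := panel_coordinates_exist e_sym e_irr B2_inf.
have [[c0] [d0]] := (building_inhabited B1, building_inhabited B2).
pose p0 : coupled b1 b2 := (c0, d0).
pose graph c d := exists f, walk f p0 (c, d).
have graphC c d : graph c d <->
    exists f, walk f ((d0, c0) : coupled b2 b1) (d, c).
  by split=> [] [f /walk_coupledC]; exists f.
have graph_step i c d c' d' : graph c d ->
    adj (c := coupled b1 b2) i (c, d) (c', d') -> graph c' d'.
  move=> [f pd] dd'; exists (f ++ [:: i]); apply/walk_cat; exists (c, d) => //.
  by exists (c', d').
have graph_fun c d d' : graph c d -> graph c d' -> d = d'.
  by move=> [f pd] [g]; exact: (coupled_functional e_sym e_irr b1P b2P pd).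
have graph_inj c c' d : graph c d -> graph c' d -> c = c'.
  move=> /graphC[f pd] /graphC[g].
  exact: (coupled_functional e_sym e_irr b2P b1P pd).
have /choice[phi phiP] : forall c, exists d, graph c d.
  by move=> c; have [d [f]] := coupled_total b2P p0 c; exists d, f.
have /choice[psi psiP] : forall d, exists c, graph c d.
  move=> d; have [c cP] := coupled_total b1P ((d0, c0) : coupled b2 b1) d.
  by exists c; apply/graphC.
exists phi.
  exists psi => [c|d]; first exact: graph_inj (psiP _) (phiP c).
  exact: graph_fun (phiP _) (psiP d).
move=> i c c'; split=> cc'.
  have [d dd'] := coupled_lift b2P (p := ((c, phi c) : coupled b1 b2)) cc'.
  rewrite -(graph_fun _ _ _ (graph_step _ _ _ _ _ (phiP c) dd') (phiP c')).
  by case: dd'.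
have [d [/= dd' cd dcb]] :=
  coupled_lift b1P (p := ((phi c, c) : coupled b2 b1)) cc'.
rewrite (graph_inj c' d (phi c')) //; apply: (graph_step i _ _ _ _ (phiP c)).
by split=> //=; rewrite -GRing.opprB dcb GRing.opprB.
Qed.
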